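(* Let $r\in\mathbb{N}$, $\overrightarrow{u}=(u_1,u_2,\ldots,u_r)\in\mathbb{R}^r$ and let $n\ge 0$ be an integer. For real $x$ with $|x|\le 1$, $$P_3(n,x,\overrightarrow{u},r)=\sum_{j=0}^n\binom{n}{j}H_j(\overrightarrow{u},r)\,T_{n-j}(x),\qquad\text{where } P_3(n,x,\overrightarrow{u},r)=P_1\big(n,x,\sqrt{1-x^2},\overrightarrow{u},r\big),$$ and for real $x$ with $|x|<1$, $$P_4(n,x,\overrightarrow{u},r)=\sum_{j=0}^n\binom{n}{j}H_j(\overrightarrow{u},r)\,U_{n-j-1}(x),\qquad\text{where } P_4(n,x,\overrightarrow{u},r)=\frac{P_2\big(n,x,\sqrt{1-x^2},\overrightarrow{u},r\big)}{\sqrt{1-x^2}},$$ with the convention $U_{-1}(x)=0$.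
   Context: The generalized Hermite–Kampé de Fériet polynomials $H_n(\overrightarrow{u},r)$ are defined by $\exp\big(\sum_{j=1}^r u_jt^j\big)=\sum_{n\ge0}H_n(\overrightarrow{u},r)\frac{t^n}{n!}$. For $x,y\in\mathbb{R}$ and $w=x+iy$, the polynomials $\mathcal{K}(n;w,\overrightarrow{u},r)$ are defined by $\exp\big(wt+\sum_{j=1}^r u_jt^j\big)=\sum_{n\ge0}\mathcal{K}(n;w,\overrightarrow{u},r)\frac{t^n}{n!}$, and $$P_1(n,x,y,\overrightarrow{u},r)=\mathrm{Re}\,\mathcal{K}(n;x+iy,\overrightarrow{u},r),\qquad P_2(n,x,y,\overrightarrow{u},r)=\mathrm{Im}\,\mathcal{K}(n;x+iy,\overrightarrow{u},r).$$ The Chebyshev polynomials of the first and second kinds $T_n$, $U_n$ are given by $\frac{1-xt}{1-2xt+t^2}=\sum_{n\ge0}T_n(x)t^n$ and $\frac{1}{1-2xt+t^2}=\sum_{n\ge0}U_n(x)t^n$. *)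

(* Defs.v *)
From mathcomp Require Import all_boot all_order all_algebra.
From mathcomp Require Import reals complex.

Set Implicit Arguments.
Unset Strict Implicit.
Unset Printing Implicit Defensive.

Import Order.TTheory GRing.Theory Num.Theory.
Local Open Scope ring_scope.
Local Open Scope complex_scope.

(* Generating functions are read in the ring F[[t]] of formal power series; a  *)
(* series is the sequence of its coefficients and 'X plays the role of t.      *)

(* exp(p) = \sum_k p^k / k!, for p without constant term: p^k then has no      *)
(* terms of degree < k, so only k <= n contributes to the coefficient of t^n.  *)
(* See fps_exp0 and fps_exp_deriv.                                             *)
Definition fps_exp (F : fieldType) (p : {poly F}) : nat -> F :=
  fun n => \sum_(k < n.+1) (p ^+ k)`_n / (k`!)%:R.

(* p / q = q_0^-1 p \sum_k (1 - q / q_0)^k, for q with q_0 != 0; again only    *)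
(* k <= n contributes to the coefficient of t^n. See fps_divP.                 *)
Definition fps_div (F : fieldType) (p q : {poly F}) : nat -> F :=
  fun n => \sum_(k < n.+1) (q`_0)^-1 * (p * (1 - (q`_0)^-1 *: q) ^+ k)`_n.

(* The component u 0 j, with j counted from 0, is the coefficient of t^(j+1).  *)
Definition hermiteH (R : realType) (r : nat) (u : 'rV[R]_r) (n : nat) : R :=
  (n`!)%:R * fps_exp (\sum_(j < r) u 0 j *: 'X^(j.+1)) n.

Definition hermiteK (R : realType) (r : nat) (u : 'rV[R]_r) (w : R[i])
    (n : nat) : R[i] :=
  (n`!)%:R * fps_exp (w *: 'X + \sum_(j < r) (u 0 j)%:C *: 'X^(j.+1)) n.

Definition P1 (R : realType) (r : nat) (u : 'rV[R]_r) (n : nat) (x y : R) : R :=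
  complex.Re (hermiteK u (x +i* y) n).

Definition P2 (R : realType) (r : nat) (u : 'rV[R]_r) (n : nat) (x y : R) : R :=
  complex.Im (hermiteK u (x +i* y) n).

Definition P3 (R : realType) (r : nat) (u : 'rV[R]_r) (n : nat) (x : R) : R :=
  P1 u n x (Num.sqrt (1 - x ^+ 2)).

Definition P4 (R : realType) (r : nat) (u : 'rV[R]_r) (n : nat) (x : R) : R :=
  P2 u n x (Num.sqrt (1 - x ^+ 2)) / Num.sqrt (1 - x ^+ 2).

Definition chebT (R : realType) (n : nat) (x : R) : R :=
  fps_div (1 - x *: 'X) (1 - (2 * x) *: 'X + 'X^2) n.

Definition chebU (R : realType) (n : nat) (x : R) : R :=
  fps_div 1 (1 - (2 * x) *: 'X + 'X^2) n.

(* U_m for m : int, with U_(-1) = 0. Indices below -1 get the junk value 0.    *)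
Definition chebUz (R : realType) (m : int) (x : R) : R :=
  if m is Posz k then chebU k x else 0.

Lemma coef_exp_small (F : fieldType) (p : {poly F}) (k n : nat) :
  p`_0 = 0 -> (n < k)%N -> (p ^+ k)`_n = 0.
Proof.
move=> p0 nk; have /factor_theorem[q ->] : root p 0.
  by rewrite /root horner_coef0 p0.
by rewrite subr0 exprMn coefMXn nk.
Qed.

Lemma coef_mul_exp_small (F : fieldType) (p g : {poly F}) (k n : nat) :
  g`_0 = 0 -> (n < k)%N -> (p * g ^+ k)`_n = 0.
Proof.
move=> g0 nk; rewrite coefM big1 // => i _.
by rewrite coef_exp_small ?mulr0 // (leq_ltn_trans (leq_subr _ _)).
Qed.

Lemma fps_exp0 (F : fieldType) (p : {poly F}) : fps_exp p 0 = 1.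
Proof. by rewrite /fps_exp big_ord1 expr0 coef1 divr1. Qed.

(* (exp p)' = p' exp p *)
Lemma fps_exp_deriv (R : numFieldType) (p : {poly R}) (n : nat) :
  p`_0 = 0 ->
  fps_exp p n.+1 *+ n.+1 = \sum_(i < n.+1) (p^`())`_i * fps_exp p (n - i).
Proof.
move=> p0.
have trunc (m : nat) : (m <= n)%N ->
    fps_exp p m = \sum_(k < n.+1) (p ^+ k)`_m / (k`!)%:R.
  move=> mn; rewrite /fps_exp (big_ord_widen _ (fun k => (p ^+ k)`_m / (k`!)%:R)
    (mn : (m.+1 <= n.+1)%N)) big_mkcond; apply: eq_bigr => k _.
  by rewrite ltnS; case: leqP => // mk; rewrite coef_exp_small ?mul0r.
under [RHS]eq_bigr => i _ do rewrite (trunc _ (leq_subr _ _)) mulr_sumr.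
rewrite exchange_big /= /fps_exp big_ord_recl /= expr0 coef1 mul0r add0r.
rewrite -sumrMnl; apply: eq_bigr => k _.
under [RHS]eq_bigr => i _ do rewrite mulrA.
rewrite -mulr_suml -coefM /bump /= add1n.
rewrite -mulrnAl -coef_deriv deriv_exp /= coefMn factS natrM invfM.
by rewrite -[X in X * _]mulr_natr -mulrA mulVKf ?pnatr_eq0.
Qed.

(* q (p / q) = p *)
Lemma fps_divP (F : fieldType) (p q : {poly F}) (n : nat) :
  q`_0 != 0 -> \sum_(i < n.+1) q`_i * fps_div p q (n - i) = p`_n.
Proof.
move=> q0; set g := 1 - (q`_0)^-1 *: q.
have g0 : g`_0 = 0 by rewrite coefB coef1 coefZ mulVf ?subrr.
have qE : (q`_0)^-1 *: q = 1 - g by rewrite /g subKr.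
have trunc (m : nat) : (m <= n)%N ->
    fps_div p q m = (q`_0)^-1 * (p * \sum_(k < n.+1) g ^+ k)`_m.
  move=> mn; rewrite mulr_sumr coef_sum mulr_sumr /fps_div -/g.
  rewrite (big_ord_widen _ (fun k => (q`_0)^-1 * (p * g ^+ k)`_m)
    (mn : (m.+1 <= n.+1)%N)) big_mkcond; apply: eq_bigr => k _.
  by rewrite ltnS; case: leqP => // mk; rewrite coef_mul_exp_small ?mulr0.
under eq_bigr => i _ do rewrite (trunc _ (leq_subr _ _)) mulrCA.
rewrite -mulr_sumr -coefM -coefZ scalerAl qE mulrCA.
have <- : 1 - g ^+ n.+1 = (1 - g) * \sum_(k < n.+1) g ^+ k.
  by rewrite -[LHS]opprB subrX1 -mulNr opprB.
by rewrite mulrBr mulr1 coefB coef_mul_exp_small ?subr0.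
Qed.

(* Main.v *)
(* Comparing exponential generating functions, exp(w t) exp(\sum_j u_j t^j)    *)
(* gives K(n; w) = \sum_j C(n, j) H_j w^(n-j). For w = x + i sqrt(1 - x^2) one *)
(* has w^2 = 2 x w - 1, so the real and imaginary parts of w^m satisfy the     *)
(* Chebyshev recurrence, whence w^m = T_m(x) + i sqrt(1 - x^2) U_(m-1)(x).     *)
Require Import Defs.
From mathcomp Require Import all_boot all_order all_algebra.
From mathcomp Require Import reals complex.
From mathcomp Require Import ring.

Import Order.TTheory GRing.Theory Num.Theory.
Local Open Scope ring_scope.

(** The law exp(p + q) = exp(p) exp(q) ([fps_expD]) splits off the factor exp(w t), and
    [hermiteK_binomial] expands K(n; w) in powers of w with real coefficients. Hence only the powers
    of w need real and imaginary parts, and on the unit circle [exp_chebyshev] supplies them.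
    [hermiteK_chebyshev] combines the two; the theorem takes y = sqrt(1 - x^2). *)

(** The equation g' = p' g gives (m+1) g_(m+1) in terms of g_0, ..., g_m, so g_0 = 1 determines the
    rest. It is required only below degree n, so that g can be a truncated series. *)
Lemma fps_exp_unique (F : numFieldType) (p g : {poly F}) (n : nat) :
  p`_0 = 0 -> g`_0 = 1 -> (forall m, (m < n)%N -> g^`()`_m = (p^`() * g)`_m) ->
  forall m, (m <= n)%N -> g`_m = fps_exp p m.
Proof.
move=> p0 g0 Dg m; elim/ltn_ind: m => -[|m] IHm mn; first by rewrite fps_exp0.
apply: (pmulrnI (ltn0Sn m)); rewrite -coef_deriv Dg // coefM fps_exp_deriv //.
apply: eq_bigr => -[i im] _ /=.
by rewrite IHm ?ltnS ?leq_subr // (leq_trans (leq_subr _ _) (ltnW mn)).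
Qed.

(** By the Leibniz rule, exp(p) exp(q) solves the differential equation that characterizes exp(p +
    q). *)
Lemma fps_expD (F : numFieldType) (p q : {poly F}) (n : nat) :
  p`_0 = 0 -> q`_0 = 0 ->
  fps_exp (p + q) n = \sum_(i < n.+1) fps_exp p i * fps_exp q (n - i).
Proof.
move=> p0 q0.
(* Truncating after t^n turns the series product into a product of polynomials, at the price that
   the differential equation holds only below degree n. *)
pose E (f : {poly F}) := \poly_(i < n.+1) fps_exp f i.
have EE (f : {poly F}) m : (m <= n)%N -> (E f)`_m = fps_exp f m.
  by move=> mn; rewrite coef_poly ltnS mn.
have DE (f : {poly F}) m : f`_0 = 0 -> (m < n)%N -> (E f)^`()`_m = (f^`() * E f)`_m.
  move=> f0 mn; rewrite coef_deriv EE // fps_exp_deriv // coefM.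
  by apply: eq_bigr => i _; rewrite EE // (leq_trans (leq_subr _ _) (ltnW mn)).
rewrite -(fps_exp_unique _ (p + q) (E p * E q) n) //.
- rewrite coefM; apply: eq_bigr => -[i lt_in] _ /=.
  by rewrite !EE ?leq_subr.
- by rewrite coefD p0 q0 addr0.
- by rewrite coefM big_ord1 subn0 !EE // !fps_exp0 mulr1.
move=> m mn; rewrite derivM derivD.
have -> : (p^`() + q^`()) * (E p * E q)
    = p^`() * E p * E q + E p * (q^`() * E q) by ring.
rewrite !coefD; congr (_ + _).
  rewrite [LHS]coefM [RHS]coefM.
  by apply: eq_bigr => -[i im] _ /=; rewrite DE // (leq_ltn_trans _ mn).
rewrite [LHS]coefM [RHS]coefM; apply: eq_bigr => i _.
by rewrite DE // (leq_ltn_trans (leq_subr _ _) mn).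
Qed.

Lemma fps_expZX (F : fieldType) (w : F) (n : nat) :
  fps_exp (w *: 'X) n = w ^+ n / (n`!)%:R.
Proof.
rewrite /fps_exp big_ord_recr /= exprZn coefZ coefXn eqxx mulr1 big1 ?add0r //.
move=> k _; rewrite exprZn coefZ coefXn.
by rewrite gtn_eqF ?ltn_ord // mulr0 mul0r.
Qed.

Lemma fps_exp_map (F F' : fieldType) (f : {rmorphism F -> F'}) (p : {poly F})
    (n : nat) :
  fps_exp (map_poly f p) n = f (fps_exp p n).
Proof.
rewrite /fps_exp rmorph_sum; apply: eq_bigr => k _.
by rewrite fmorph_div rmorph_nat -rmorphXn /= coef_map.
Qed.

Lemma hermiteK_binomial (R : realType) (r : nat) (u : 'rV[R]_r) (w : R[i])
    (n : nat) :
  hermiteK u w n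
  = \sum_(j < n.+1) ('C(n, j)%:R * hermiteH u j)%:C%C * w ^+ (n - j).
Proof.
pose p := \sum_(j < r) u 0 j *: 'X^(j.+1).
have p0 : p`_0 = 0.
  by rewrite coef_sum big1 // => j _; rewrite coefZ coefXn mulr0.
rewrite /hermiteK.
have -> : \sum_(j < r) (u 0 j)%:C%C *: 'X^(j.+1) = map_poly (real_complex R) p.
  rewrite rmorph_sum; apply: eq_bigr => j _ /=.
  by rewrite map_polyZ map_polyXn.
rewrite addrC fps_expD; last by rewrite coefZ coefX mulr0.
  rewrite mulr_sumr; apply: eq_bigr => -[j /= jn] _.
  rewrite fps_exp_map fps_expZX /hermiteH -/p -(bin_fact (jn : (j <= n)%N)).
  rewrite !rmorphM /= !rmorph_nat ?natrM.
  have f0 : (n - j)`!%:R != 0 :> R[i] by rewrite pnatr_eq0 -lt0n fact_gt0.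
  by field.
by rewrite coef_map p0.
Qed.

Section ChebyshevRecurrence.
Variables (F : fieldType) (p : {poly F}) (a : F).
Let q : {poly F} := 1 - a *: 'X + 'X^2.

Let qE i : q`_i = (i == 0)%:R - a * (i == 1)%:R + (i == 2)%:R.
Proof. by rewrite coefD coefB coef1 coefZ coefX coefXn. Qed.

Let q0 : q`_0 != 0.
Proof. by rewrite qE mulr0 subr0 addr0 oner_eq0. Qed.

Lemma fps_div_quad0 : fps_div p q 0 = p`_0.
Proof. by rewrite -(fps_divP p 0 q0) big_ord1 qE mulr0 subr0 addr0 mul1r. Qed.

Lemma fps_div_quad1 : fps_div p q 1 = p`_1 + a * p`_0.
Proof.
rewrite -(fps_divP p 1 q0) 2!big_ord_recl big_ord0 !qE /= -fps_div_quad0 /q.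
by rewrite subnn subn0; ring.
Qed.

(** This compares coefficients of t^(n+2) in q (p / q) = p. For a = 2 x and p of degree at most 1,
    it is the recurrence common to T and U. *)
Lemma fps_div_quadSS n :
  fps_div p q n.+2 = p`_n.+2 + a * fps_div p q n.+1 - fps_div p q n.
Proof.
rewrite -(fps_divP p n.+2 q0) 3!big_ord_recl big1; last first.
  by move=> i _; rewrite qE /= mulr0 subr0 addr0 mul0r.
by rewrite !qE /= /bump /= subn0 !subSS !subn0; ring.
Qed.

End ChebyshevRecurrence.

Lemma exp_chebyshev (R : realType) (x y : R) (n : nat) :
  x ^+ 2 + y ^+ 2 = 1 ->
  ((x +i* y)%C) ^+ n = (chebT n x +i* (y * chebUz (n%:Z - 1) x))%C.
Proof.
move=> xy1.
pose P n := ((x +i* y)%C) ^+ n = (chebT n x +i* (y * chebUz (n%:Z - 1) x))%C.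
have T0 : chebT 0 x = 1.
  by rewrite /chebT fps_div_quad0 coefB coef1 coefZ coefX mulr0 subr0.
have T1 : chebT 1 x = x.
  rewrite /chebT fps_div_quad1 !coefB !coef1 !coefZ !coefX /=; ring.
have U0 : chebU 0 x = 1 by rewrite /chebU fps_div_quad0 coef1.
have TS m : chebT m.+2 x = 2 * x * chebT m.+1 x - chebT m x.
  by rewrite /chebT fps_div_quadSS coefB coef1 coefZ coefX mulr0 subr0 add0r.
have Uz m : chebUz (m.+1%:Z - 1) x = chebU m x by rewrite -addn1 PoszD addrK.
have US m : chebUz (m.+2%:Z - 1) x
    = 2 * x * chebUz (m.+1%:Z - 1) x - chebUz (m%:Z - 1) x.
  (* The case m = 0 is U_1 = 2 x U_0 - U_(-1), where the convention U_(-1) = 0 enters. *)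
  rewrite !Uz; case: m => [|m].
    by rewrite U0 /chebU fps_div_quad1 !coef1 add0r subr0.
  by rewrite Uz /chebU fps_div_quadSS coef1 add0r.
suff: P n /\ P n.+1 by case.
elim: n => [|n [IH0 IH1]]; rewrite /P.
  by rewrite expr0 expr1 T0 T1 Uz U0 mulr0 mulr1.
split=> //.
have -> : (x +i* y)%C ^+ n.+2 = (2 * x)%:C%C * (x +i* y)%C ^+ n.+1 - (x +i* y)%C ^+ n.
  have w2 : (x +i* y)%C ^+ 2 = (2 * x)%:C%C * (x +i* y)%C - 1.
    have y2 : y ^+ 2 = 1 - x ^+ 2 by rewrite -xy1 addrC addKr.
    (* The zero terms come from the imaginary parts of [(2 * x)%:C] and 1; they match the components
       of the complex identity. *)
    have re : x * x - y * y = 2 * x * x - 0 * y - 1 by ring: y2.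
    have im : x * y + y * x = 2 * x * y + 0 * x - 0 by ring.
    by apply/eqP; rewrite eq_complex; apply/andP; split; apply/eqP.
  by rewrite -addn2 exprD w2 exprS; ring.
rewrite IH0 IH1 TS US; apply/eqP; rewrite eq_complex /=.
by apply/andP; split; apply/eqP; ring.
Qed.

(** The factor y is kept outside the sum so that the division in [P4] cancels it. *)
Lemma hermiteK_chebyshev (R : realType) (r : nat) (u : 'rV[R]_r) (n : nat)
    (x y : R) :
  x ^+ 2 + y ^+ 2 = 1 ->
  hermiteK u (x +i* y)%C n
  = ((\sum_(0 <= j < n.+1) 'C(n, j)%:R * hermiteH u j * chebT (n - j) x) +i*
     (y * \sum_(0 <= j < n.+1)
            'C(n, j)%:R * hermiteH u j * chebUz (n%:Z - j%:Z - 1) x))%C.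
Proof.
move=> xy1; rewrite hermiteK_binomial !big_mkord mulr_sumr.
apply/eqP; rewrite eq_complex /= !raddf_sum /=.
apply/andP; split; apply/eqP; apply: eq_bigr => -[j /= jn] _;
  rewrite exp_chebyshev // -subzn //=; ring.
Qed.

Theorem theorem33 (R : realType) (r : nat) (u : 'rV[R]_r) (n : nat) :
  (forall x : R, `|x| <= 1 ->
     P3 u n x
     = \sum_(0 <= j < n.+1) 'C(n, j)%:R * hermiteH u j * chebT (n - j) x)
  /\
  (forall x : R, `|x| < 1 ->
     P4 u n x
     = \sum_(0 <= j < n.+1)
         'C(n, j)%:R * hermiteH u j * chebUz (n%:Z - j%:Z - 1) x).
Proof.
have circle (x : R) : `|x| <= 1 -> x ^+ 2 + Num.sqrt (1 - x ^+ 2) ^+ 2 = 1.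
  by move=> x1; rewrite sqr_sqrtr ?subrKC // subr_ge0 -real_normK ?num_real // expr_le1.
split=> x x1; first by rewrite /P3 /P1 hermiteK_chebyshev ?circle.
have y0 : Num.sqrt (1 - x ^+ 2) != 0.
  by rewrite gt_eqF // sqrtr_gt0 subr_gt0 -real_normK ?num_real // expr_lt1.
by rewrite /P4 /P2 hermiteK_chebyshev ?circle ?ltW //= mulrAC divff // mul1r.
Qed.
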